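(* There exist universal constants $c_1,c_2>0$ such that for any $S,A,B,H$ and any $0<\varepsilon\le c_1H$, one can construct a collection $\{\mathcal{MG}_\theta:\theta\in\Theta\}$ of non-stationary finite-horizon two-player zero-sum Markov games with $S$ states, $A$ max-player actions, $B$ min-player actions and horizon $H$ such that, whenever the total number $N$ of generative-model samples satisfies $N\le\frac{c_2H^4S(A+B)}{\varepsilon^2}$, $$\inf_{\widehat\mu,\widehat\nu}\max_{\theta\in\Theta}\mathbb P^{\mathcal{MG}_\theta}\big\{\mathsf{NE\text{-}gap}(\widehat\mu,\widehat\nu)>\varepsilon\big\}\ge\frac14,$$ where the infimum is over all estimators $(\widehat\mu,\widehat\nu)$ computed from $N$ samples, and $\mathbb P^{\mathcal{MG}_\theta}$ denotes probability when the game is $\mathcal{MG}_\theta$.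
   Context: Markov game: states $\mathcal S$ ($|\mathcal S|=S$), actions $\mathcal A$ ($A$), $\mathcal B$ ($B$), horizon $H$, transitions $P_h(\cdot\mid s,a,b)$, rewards $r_h(s,a,b)\in[0,1]$. $V_h^{\mu,\nu}(s)=\mathbb E[\sum_{t=h}^Hr_t(s_t,a_t,b_t)\mid s_h=s]$ with $a_t\sim\mu_t(\cdot\mid s_t)$, $b_t\sim\nu_t(\cdot\mid s_t)$ independent; $V^{\star,\nu}=\max_\mu V^{\mu,\nu}$, $V^{\mu,\star}=\min_\nu V^{\mu,\nu}$; $\mathsf{NE\text{-}gap}(\mu,\nu)=\max_s\max\{V_1^{\star,\nu}(s)-V_1^{\mu,\nu}(s),V_1^{\mu,\nu}(s)-V_1^{\mu,\star}(s)\}$. A generative model returns, for any queried $(s,a,b,h)$, an independent $s'\sim P_h(\cdot\mid s,a,b)$.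
   Formalization: Assumes S≥2, H≥2, A,B≥1 and A+B≥3: for A=B=1 the NE-gap is always 0, and for S=1 or H=1 (rewards known, common to all games) the game is fully known, so the claim fails. Estimators may query adaptively; their internal randomness has finitely many values. *)

(* Defs.v *)
From HB Require Import structures.
From mathcomp Require Import all_boot all_order all_algebra.
From mathcomp Require Import classical_sets reals.
Set Implicit Arguments.
Unset Strict Implicit.
Unset Printing Implicit Defensive.
Import Order.TTheory GRing.Theory Num.Theory.
Local Open Scope ring_scope.
Local Open Scope classical_set_scope.

(* Finite-horizon two-player zero-sum Markov game with states 'I_S,
   max-player actions 'I_A, min-player actions 'I_B, horizon H.
   Stages are indexed by t : nat, t = 0 .. H-1 (stage t here is step t+1
   of the paper); only stages t < H are relevant. *)

Definition kernel (R : realType) (S A B : nat) :=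
  nat -> 'I_S -> 'I_A -> 'I_B -> 'I_S -> R.
Definition reward (R : realType) (S A B : nat) :=
  nat -> 'I_S -> 'I_A -> 'I_B -> R.
Definition policyA (R : realType) (S A : nat) := nat -> 'I_S -> 'I_A -> R.
Definition policyB (R : realType) (S B : nat) := nat -> 'I_S -> 'I_B -> R.

Definition is_kernel (R : realType) (S A B H : nat) (P : kernel R S A B) :=
  forall t, (t < H)%N -> forall s a b,
    (forall s', 0 <= P t s a b s') /\ \sum_(s' : 'I_S) P t s a b s' = 1.

Definition is_reward (R : realType) (S A B H : nat) (r : reward R S A B) :=
  forall t, (t < H)%N -> forall s a b, 0 <= r t s a b <= 1.

Definition is_policyA (R : realType) (S A H : nat) (mu : policyA R S A) :=
  forall t, (t < H)%N -> forall s,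
    (forall a, 0 <= mu t s a) /\ \sum_(a : 'I_A) mu t s a = 1.
Definition is_policyB (R : realType) (S B H : nat) (nu : policyB R S B) :=
  forall t, (t < H)%N -> forall s,
    (forall b, 0 <= nu t s b) /\ \sum_(b : 'I_B) nu t s b = 1.

(* value_to_go k s = V_{H-k+1}^{mu,nu}(s) (paper's indexing): expected sum
   of rewards of the last k steps, starting from s at stage H-k. *)
Fixpoint value_to_go (R : realType) (S A B H : nat) (P : kernel R S A B)
  (r : reward R S A B) (mu : policyA R S A) (nu : policyB R S B)
  (k : nat) (s : 'I_S) : R :=
  match k with
  | 0 => 0
  | k'.+1 =>
      \sum_(a : 'I_A) \sum_(b : 'I_B)
        mu (H - k'.+1)%N s a * nu (H - k'.+1)%N s b *
        (r (H - k'.+1)%N s a b +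
         \sum_(s' : 'I_S) P (H - k'.+1)%N s a b s' *
                          value_to_go H P r mu nu k' s')
  end.

Definition V1 (R : realType) (S A B H : nat) (P : kernel R S A B)
  (r : reward R S A B) (mu : policyA R S A) (nu : policyB R S B) (s : 'I_S) : R :=
  value_to_go H P r mu nu H s.

Definition V1_star_nu (R : realType) (S A B H : nat) (P : kernel R S A B)
  (r : reward R S A B) (nu : policyB R S B) (s : 'I_S) : R :=
  sup [set V1 H P r mu nu s | mu in is_policyA H].

Definition V1_mu_star (R : realType) (S A B H : nat) (P : kernel R S A B)
  (r : reward R S A B) (mu : policyA R S A) (s : 'I_S) : R :=
  inf [set V1 H P r mu nu s | nu in is_policyB H].

Definition NE_gap (R : realType) (S A B H : nat) (P : kernel R S A B)
  (r : reward R S A B) (mu : policyA R S A) (nu : policyB R S B) : R :=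
  \big[Num.max/0]_(s : 'I_S)
     Num.max (V1_star_nu H P r nu s - V1 H P r mu nu s)
             (V1 H P r mu nu s - V1_mu_star H P r mu s).

(* Generative model with N adaptively chosen queries.
   A query is (h, s, a, b); the answer is s' ~ P_h(.|s,a,b).
   A (deterministic, given its internal seed) sampling strategy [qry] chooses
   the i-th query from the i previous answers; [o] is the tuple of the N
   answers.  Probability of the answer sequence o: *)
Definition sample_prob (R : realType) (S A B H N : nat) (P : kernel R S A B)
  (qry : seq 'I_S -> 'I_H * 'I_S * 'I_A * 'I_B) (o : N.-tuple 'I_S) : R :=
  \prod_(i < N)
    let: (h, s, a, b) := qry (take i o) in P (h : nat) s a b (tnth o i).

(* Probability, under game (P, r), that a (randomized) estimator with seed
   space Omega (seed law q), query strategy qry and output map out returns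
   (mu_hat, nu_hat) with NE-gap(mu_hat, nu_hat) > eps. *)
Definition fail_prob (R : realType) (S A B H N : nat) (Omega : finType)
  (q : Omega -> R)
  (qry : Omega -> seq 'I_S -> 'I_H * 'I_S * 'I_A * 'I_B)
  (out : Omega -> N.-tuple 'I_S -> policyA R S A * policyB R S B)
  (P : kernel R S A B) (r : reward R S A B) (eps : R) : R :=
  \sum_(w : Omega) q w *
    \sum_(o : N.-tuple 'I_S)
       sample_prob P (qry w) o *
       (if eps < NE_gap H P r (out w o).1 (out w o).2 then 1 else 0).

Arguments fail_prob {R S A B H N Omega} q qry out P r eps.

(* Main.v *)
Require Import Defs.
From HB Require Import structures.
From mathcomp Require Import all_boot all_order all_algebra.
From mathcomp Require Import classical_sets reals exp.
From mathcomp Require Import ring lra zify.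
Import Order.TTheory GRing.Theory Num.Theory.
Set Implicit Arguments.
Unset Strict Implicit.
Unset Printing Implicit Defensive.
Local Open Scope ring_scope.

(** The player with more actions, [n >= 2] of them, has to leave a state [s] for
    the absorbing state [ord0], which is the good state for that player; the
    opponent has no influence.  An action leaves with probability
    [p = 1 / (4 H)], action 0 with probability [p + d], and in half of the cells
    [(t, s)] a secret action leaves with probability [p + 2 d], where
    [d = 120 eps / H^2].  A wrong action at a stage of the first half of the
    game costs at least of order [d H], hence a policy that puts, on average
    over these stages, mass less than 4/5 on the best actions has gap larger
    than [eps].

    Flipping the presence of the secret in one cell changes the law of the
    samples only through the queries of one action in that cell, each of which
    contributes at most [8 d^2 / p], of order [eps^2 / H^3], to the
    Kullback-Leibler divergence.  With [N] queries for [n - 1] potential secret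
    actions in each of the order of [H S] cells, an average cell stays
    undetected, and the best actions get an average mass of less than 3/5.  If
    every game failed with probability less than 1/4, this average would exceed
    [4/5 * 3/4 = 3/5]. *)

(** * Laws of adaptively sampled answers and change of measure *)

Section AdaptiveSampling.
Variables (R : realType) (T : finType).
Implicit Types (k g : seq T -> T -> R).

(** [k h s] is the factor of the answer [s] after the history [h]: a conditional probability, or a
    ratio of two of them. The dependence on [h] absorbs the query strategy. *)
Definition path_prob k N (o : N.-tuple T) : R :=
  \prod_(i < N) k (take i o) (tnth o i).

Definition path_sum g N (o : N.-tuple T) : R :=
  \sum_(i < N) g (take i o) (tnth o i).

Lemma path_prob_cons k N s (o : N.-tuple T) :
  path_prob k (cons_tuple s o) =
  k [::] s * path_prob (fun h => k (s :: h)) o.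
Proof.
rewrite /path_prob big_ord_recl; congr (_ * _).
by apply: eq_bigr => i _; rewrite /= tnthS.
Qed.

Lemma path_sum_cons g N s (o : N.-tuple T) :
  path_sum g (cons_tuple s o) =
  g [::] s + path_sum (fun h => g (s :: h)) o.
Proof.
rewrite /path_sum big_ord_recl; congr (_ + _).
by apply: eq_bigr => i _; rewrite /= tnthS.
Qed.

Lemma big_tuple_recl N (F : N.+1.-tuple T -> R) :
  \sum_o F o = \sum_s \sum_(o : N.-tuple T) F (cons_tuple s o).
Proof.
rewrite pair_bigA /= (reindex (fun p => cons_tuple p.1 p.2)) //=.
exists (fun o => (thead o, behead_tuple o)) => [[s o] _|o _] /=.
  by congr pair; apply: val_inj.
by rewrite [o in RHS]tuple_eta; apply: val_inj.
Qed.

Lemma path_prob_ge0 k N (o : N.-tuple T) :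
  (forall h s, 0 <= k h s) -> 0 <= path_prob k o.
Proof. by move=> k0; apply: prodr_ge0. Qed.

Lemma path_prob_sum1 k N :
  (forall h, \sum_s k h s = 1) -> \sum_(o : N.-tuple T) path_prob k o = 1.
Proof.
elim: N k => [|N IH] k k1.
  rewrite (big_pred1 [tuple]) => [|o]; last exact/esym/eqP/tuple0.
  by rewrite /path_prob big_ord0.
rewrite big_tuple_recl -[RHS](k1 [::]); apply: eq_bigr => s _.
under eq_bigr do rewrite path_prob_cons.
by rewrite -mulr_sumr IH ?mulr1.
Qed.

(** Conditioning on the first answer reduces the claim to conditional means given the history. This
    serves as the chain rule for the Kullback-Leibler divergence under adaptive queries. *)
Lemma path_sum_mono k g g' N :
  (forall h s, 0 <= k h s) -> (forall h, \sum_s k h s = 1) ->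
  (forall h, \sum_s k h s * g h s <= \sum_s k h s * g' h s) ->
  \sum_(o : N.-tuple T) path_prob k o * path_sum g o <=
  \sum_(o : N.-tuple T) path_prob k o * path_sum g' o.
Proof.
elim: N k g g' => [|N IH] k g g' k0 k1 le_g.
  by apply: ler_sum => o _; rewrite /path_sum !big_ord0.
have peel (f : seq T -> T -> R) :
    \sum_(o : N.+1.-tuple T) path_prob k o * path_sum f o =
    \sum_s k [::] s * f [::] s +
    \sum_s k [::] s * \sum_(o : N.-tuple T)
       path_prob (fun h => k (s :: h)) o * path_sum (fun h => f (s :: h)) o.
  rewrite big_tuple_recl -big_split; apply: eq_bigr => s _ /=.
  under eq_bigr do rewrite path_prob_cons path_sum_cons mulrDr -!mulrA.
  rewrite big_split /= -!mulr_sumr -mulr_suml.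
  by rewrite path_prob_sum1 ?mul1r // => h; apply: k1.
rewrite !peel lerD //; apply: ler_sum => s _.
by rewrite ler_wpM2l // IH // => h.
Qed.

Lemma ln_path_prob k N (o : N.-tuple T) :
  (forall h s, 0 < k h s) ->
  0 < path_prob k o /\ ln (path_prob k o) = path_sum (fun h s => ln (k h s)) o.
Proof.
move=> k0; rewrite /path_prob /path_sum.
apply: (big_rec2 (fun x y => 0 < x /\ ln x = y)); first by rewrite ln1.
move=> i x y _ [x0 <-]; split; first by rewrite mulr_gt0.
by rewrite lnM ?posrE.
Qed.

Lemma ln_le_sub1 (x : R) : 0 < x -> ln x <= x - 1.
Proof.
by move=> x0; rewrite -{1}(subrKC 1 x); apply: le_ln1Dx; lra.
Qed.

(* The right-hand side is convex in the likelihood ratio [x], and the bound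
   comes from its tangent line at [x = 1 + c]. *)
Lemma likelihood_ratio_bound (c f x : R) : 0 < c -> 0 <= f <= 1 -> 0 < x ->
  f * (x - 1) <= c + (1 + c^-1) * (x - 1 - ln x).
Proof.
move=> c0 /andP[f0 f1] x0.
have lnx := ln_le_sub1 x0.
have ln_tangent : ln x <= (x - 1 - c) / (1 + c) + c.
  rewrite -[X in ln X](divfK (_ : 1 + c != 0)); last by rewrite gt_eqF; lra.
  rewrite lnM ?posrE ?divr_gt0 //; [|lra..].
  have -> : (x - 1 - c) / (1 + c) = x / (1 + c) - 1.
    by field; rewrite gt_eqF; lra.
  apply: lerD; first by apply: ln_le_sub1; rewrite divr_gt0 //; lra.
  by apply: le_ln1Dx; lra.
have ci : 0 < c^-1 by rewrite invr_gt0.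
have [x1|x1] := leP x 1.
  apply: (@le_trans _ _ 0); first by rewrite mulr_ge0_le0 //; lra.
  by rewrite addr_ge0 ?mulr_ge0 //; lra.
apply: (@le_trans _ _ (x - 1)); first by rewrite ler_piMl //; lra.
have E : x - 1 = c + (1 + c^-1) * (x - 1 - ((x - 1 - c) / (1 + c) + c)).
  by field; apply/andP; split; rewrite gt_eqF //; lra.
by rewrite [X in X <= _]E lerD2l ler_wpM2l ?lerD2l ?lerN2 //; lra.
Qed.

(** [likelihood_ratio_bound] is integrated against [path_prob k]: the term [x - 1] has mean zero,
    and [- ln x] gives the divergence, at most [kappa] times the expected number of hits. The free
    parameter [c] replaces the square root of Pinsker's inequality. *)
Lemma change_of_measure k rho (hit : seq T -> bool) (kappa c : R) N
    (F : N.-tuple T -> R) :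
  (forall h s, 0 <= k h s) -> (forall h, \sum_s k h s = 1) ->
  (forall h s, 0 < rho h s) -> (forall h, \sum_s k h s * rho h s = 1) ->
  (forall h, \sum_s k h s * - ln (rho h s) <= kappa * (hit h)%:R) ->
  0 < c -> (forall o, 0 <= F o <= 1) ->
  \sum_o path_prob (fun h s => k h s * rho h s) o * F o <=
  \sum_o path_prob k o * F o + c + (1 + c^-1) * kappa *
    \sum_(o : N.-tuple T) path_prob k o * path_sum (fun h _ => (hit h)%:R) o.
Proof.
move=> k0 k1 rho0 krho1 kl c0 F01.
have ppM (o : N.-tuple T) : path_prob (fun h s => k h s * rho h s) o =
    path_prob k o * path_prob rho o by rewrite /path_prob big_split.
have KL : \sum_(o : N.-tuple T) path_prob k o * - ln (path_prob rho o) <=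
    kappa * \sum_(o : N.-tuple T)
      path_prob k o * path_sum (fun h _ => (hit h)%:R) o.
  have -> : kappa * \sum_(o : N.-tuple T)
      path_prob k o * path_sum (fun h _ => (hit h)%:R) o =
    \sum_(o : N.-tuple T)
      path_prob k o * path_sum (fun h _ => kappa * (hit h)%:R) o.
    rewrite mulr_sumr; apply: eq_bigr => o _.
    by rewrite /path_sum -mulr_sumr mulrCA.
  under eq_bigr => o _.
    rewrite (ln_path_prob o rho0).2 /path_sum -sumrN.
    rewrite -/(path_sum (fun h s => - ln (rho h s)) o).
    over.
  apply: path_sum_mono => // h.
  by rewrite -[X in _ <= X]mulr_suml k1 mul1r.
have pos_c : 0 < 1 + c^-1 by rewrite addr_gt0 ?invr_gt0.
apply: (@le_trans _ _ (\sum_(o : N.-tuple T) (path_prob k o * F o +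
    path_prob k o * c + (1 + c^-1) *
      (path_prob (fun h s => k h s * rho h s) o - path_prob k o +
       path_prob k o * - ln (path_prob rho o))))).
  apply: ler_sum => o _; rewrite ppM.
  have := likelihood_ratio_bound c0 (F01 o) (ln_path_prob o rho0).1.
  move/(ler_wpM2l (path_prob_ge0 o k0)); rewrite -lerBlDl => le_o.
  by rewrite -subr_ge0; rewrite -subr_ge0 in le_o; lra.
rewrite !big_split /= -mulr_suml path_prob_sum1 // mul1r lerD2l -mulrA.
rewrite -mulr_sumr ler_pM2l // !big_split /= sumrN !path_prob_sum1 //.
by rewrite subrr add0r.
Qed.

End AdaptiveSampling.

(** * Time spent in a state that is left at a small rate *)

Section StayingTime.
Variable R : realType.

(* The expected number of the last [k] stages spent in a state that is left
   with probability [q t] at stage [t]. *)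
Fixpoint staying_time (H : nat) (q : nat -> R) (k : nat) : R :=
  if k is k'.+1 then 1 + (1 - q (H - k'.+1)%N) * staying_time H q k' else 0.

Lemma staying_time_bounds H q k : (k <= H)%N ->
  (forall t, (t < H)%N -> 0 <= q t <= 1) -> 0 <= staying_time H q k <= k%:R.
Proof.
move=> kH q01; elim: k kH => [|k IH] kH /=; first by rewrite lexx.
have /andP[u0 uk] := IH (ltnW kH).
have /andP[q0 q1] : 0 <= q (H - k.+1)%N <= 1 by apply: q01; lia.
have := mulr_ge0 q0 u0.
have : 0 <= (1 - q (H - k.+1)%N) * staying_time H q k.
  by rewrite mulr_ge0 //; lra.
by rewrite -[k.+1]addn1 natrD; lra.
Qed.

Section Gap.
Variables (H : nat) (q q' : nat -> R).
Hypothesis H_gt0 : (0 < H)%N.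
Hypothesis q_le : forall t, (t < H)%N -> 0 <= q t <= q' t.
Hypothesis q'_small : forall t, (t < H)%N -> q' t <= (2 * H%:R)^-1.

Let h0 : 0 < H%:R :> R. Proof. by rewrite ltr0n. Qed.
Let h1 : 1 <= H%:R :> R. Proof. by rewrite ler1n. Qed.
Let e_le : (2 * H%:R)^-1 <= 2^-1 :> R.
Proof. have := h1; have := h0; by move=> ? ?; rewrite lef_pV2 ?posrE; lra. Qed.
Let eH : H%:R * (2 * H%:R)^-1 = 2^-1 :> R.
Proof. by field; rewrite gt_eqF. Qed.

(** Each stage adds one and loses at most [H%:R * (2 * H%:R)^-1], that is one half. *)
Lemma staying_time_ge k : (k <= H)%N -> k%:R / 2 <= staying_time H q' k.
Proof.
have := h0; have := h1; have := e_le => le_e le_h1 lt_h0.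
elim: k => [|k IH] kH /=; first by rewrite mul0r.
have tH : (H - k.+1 < H)%N by lia.
have /andP[q0 qq'] := q_le tH; have q's := q'_small tH.
have /andP[u0 uk] : 0 <= staying_time H q' k <= k%:R.
  apply: staying_time_bounds => [|t lt_tH]; first exact: ltnW.
  have /andP[? ?] := q_le lt_tH; have := q'_small lt_tH.
  by move=> ?; apply/andP; split; lra.
have kh : k%:R <= H%:R :> R by rewrite ler_nat ltnW.
have : q' (H - k.+1)%N * staying_time H q' k <= 2^-1.
  by rewrite -eH mulrC ler_pM //; lra.
have := IH (ltnW kH).
by rewrite -[k.+1]addn1 natrD; lra.
Qed.

(** Leaving at stage [t] saves the rest of the stay, on average at least half of the [H - t.+1]
    later stages. This counts only if the state has not been left before, which has probability at
    least 1/2. *)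
Lemma staying_time_gap :
  2^-1 * \sum_(t < H) (q' t - q t) * ((H - t.+1)%:R / 2) <=
  staying_time H q H - staying_time H q' H.
Proof.
have := h0; have := h1; have := e_le => le_e le_h1 lt_h0.
pose loss k := \sum_(j < k)
  (q' (H - j.+1)%N - q (H - j.+1)%N) * (j%:R / 2).
have loss_ge0 k : (k <= H)%N -> 0 <= loss k.
  move=> kH; apply: sumr_ge0 => j _.
  have /q_le/andP[_ ?] : (H - j.+1 < H)%N by have := ltn_ord j; lia.
  by rewrite mulr_ge0 ?subr_ge0 ?divr_ge0.
(* The factor bounds the probability of staying for [k] stages from below and reaches 1/2 at
   [k = H]. *)
have gap k : (k <= H)%N -> (1 - k%:R * (2 * H%:R)^-1) * loss k <=
    staying_time H q k - staying_time H q' k.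
  elim: k => [|k IH] kH; first by rewrite /loss big_ord0 /= mulr0 subrr.
  have tH : (H - k.+1 < H)%N by lia.
  have /andP[q0 qq'] := q_le tH; have q's := q'_small tH.
  have IHk := IH (ltnW kH).
  have Lk := loss_ge0 k (ltnW kH).
  have u'k := staying_time_ge (ltnW kH).
  have kh : (k.+1%:R : R) <= H%:R by rewrite ler_nat.
  have ke : k.+1%:R * (2 * H%:R)^-1 <= 2^-1 :> R.
    by rewrite -eH ler_wpM2r // invr_ge0; lra.
  rewrite {1}/loss big_ord_recr /= -/(loss k) mulrDr.
  set t := (H - k.+1)%N in tH q0 qq' q's *.
  set e := (2 * H%:R)^-1 in ke q's le_e IHk *.
  have e0 : 0 <= e by rewrite invr_ge0; lra.
  have k1 : (k.+1%:R : R) = k%:R + 1 by rewrite -[k.+1]addn1 natrD.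
  have k0 : 0 <= k%:R :> R by [].
  set u := staying_time H q k in IHk *.
  set u' := staying_time H q' k in IHk u'k *.
  set x := loss k in Lk IHk *.
  (* The old gap damped by [1 - q t], plus the loss incurred at stage [t] itself. *)
  have -> : 1 + (1 - q t) * u - (1 + (1 - q' t) * u') =
    (1 - q t) * (u - u') + (q' t - q t) * u' by ring.
  apply: lerD.
    apply: (@le_trans _ _ ((1 - q t) * ((1 - k%:R * e) * x))); last first.
      by rewrite ler_wpM2l //; lra.
    rewrite mulrA ler_wpM2r //.
    have : q t * (1 - k%:R * e) <= e * 1.
      by rewrite ler_pM //; nra.
    by rewrite k1; lra.
  apply: (@le_trans _ _ ((q' t - q t) * (k%:R / 2))).
    have ke0 : 0 <= k.+1%:R * e by rewrite mulr_ge0.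
    by apply: ler_piMl; rewrite ?mulr_ge0 ?divr_ge0 //; lra.
  by rewrite ler_wpM2l //; lra.
have := gap H (leqnn H).
rewrite eH; have -> : 1 - 2^-1 = 2^-1 :> R by field.
apply: le_trans; rewrite ler_wpM2l ?invr_ge0 //.
(* [loss] counts the stages from the end. *)
rewrite /loss (reindex_inj rev_ord_inj) /=.
apply: ler_sum => j _.
by have -> : (H - (H - j.+1).+1 = j)%N by have := ltn_ord j; lia.
Qed.

End Gap.
End StayingTime.

(** * Games in which one player decides how fast a state is left *)

Section LeaveGame.
Variables (R : realType) (S' n H : nat).
Notation S := S'.+1.
Implicit Types (l pi : nat -> 'I_S -> 'I_n -> R).

Definition leave_kernel l t (s : 'I_S) a (s' : 'I_S) : R :=
  if s == ord0 then (s' == ord0)%:R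
  else l t s a * (s' == ord0)%:R + (1 - l t s a) * (s' == s)%:R.

Definition leave_rate l pi (s : 'I_S) t : R := \sum_a pi t s a * l t s a.

Lemma leave_kernelE l t s a (v : 'I_S -> R) :
  \sum_s' leave_kernel l t s a s' * v s' =
  if s == ord0 then v ord0 else l t s a * v ord0 + (1 - l t s a) * v s.
Proof.
have pick x : \sum_s' (s' == x)%:R * v s' = v x.
  rewrite (bigD1 x) //= eqxx mul1r big1 ?addr0 // => y /negPf ->.
  by rewrite mul0r.
rewrite /leave_kernel; case: eqP => _; first exact: pick.
under eq_bigr do rewrite mulrDl -!mulrA.
by rewrite big_split /= -!mulr_sumr !pick.
Qed.

Lemma leave_kernel_stochastic l t s a : 0 <= l t s a <= 1 ->
  (forall s', 0 <= leave_kernel l t s a s') /\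
  \sum_s' leave_kernel l t s a s' = 1.
Proof.
move=> /andP[l0 l1]; split=> [s'|].
  rewrite /leave_kernel; case: ifP => // _.
  by rewrite addr_ge0 ?mulr_ge0 //; lra.
under eq_bigr do rewrite -[leave_kernel _ _ _ _ _]mulr1.
by rewrite (leave_kernelE l t s a (fun=> 1)); case: ifP => // _; ring.
Qed.

Lemma leave_rate_bounds l pi s t (M : R) :
  is_policyA H pi -> (t < H)%N -> (forall a, 0 <= l t s a <= M) ->
  0 <= leave_rate l pi s t <= M.
Proof.
move=> /(_ t) P tH lM; have [pi0 pi1] := P tH s.
rewrite /leave_rate; apply/andP; split.
  by apply: sumr_ge0 => a _; rewrite mulr_ge0 //; case/andP: (lM a).
rewrite -[M]mul1r -pi1 mulr_suml; apply: ler_sum => a _.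
by rewrite ler_wpM2l //; case/andP: (lM a).
Qed.

(** The opponent's mixture sums to one and disappears. A state other than [ord0] is either kept or
    left for good, so the reward collected is the time spent there, which the min-player wants to
    shorten. *)
Lemma min_chooser_value A l (mu : policyA R S A) (nu : policyB R S n) k s :
  is_policyA H mu -> is_policyB H nu -> (k <= H)%N ->
  value_to_go H (fun t s _ b => leave_kernel l t s b)
    (fun _ s _ _ => (s != ord0)%:R) mu nu k s =
  (s != ord0)%:R * staying_time H (leave_rate l nu s) k.
Proof.
move=> muP nuP; elim: k s => [|k IH] s kH /=; first by rewrite mulr0.
have tH : (H - k.+1 < H)%N by lia.
have [_ mu1] := muP _ tH s; have [_ nu1] := nuP _ tH s.
set u := staying_time H (leave_rate l nu s) k.
transitivity (\sum_a mu (H - k.+1)%N s a * ((s != ord0)%:R *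
    \sum_b (nu (H - k.+1)%N s b * (1 + u) - nu (H - k.+1)%N s b *
      l (H - k.+1)%N s b * u))).
  apply: eq_bigr => a _; rewrite !mulr_sumr; apply: eq_bigr => b _.
  rewrite leave_kernelE !IH ?(ltnW kH) //= ?eqxx.
  by case: eqP => [->|_]; rewrite /= /u ?eqxx; ring.
rewrite -mulr_suml mu1 mul1r sumrB -!mulr_suml nu1 -/(leave_rate l nu s _).
by congr (_ * _); ring.
Qed.

(** Now [ord0] pays, so the time spent elsewhere is lost and the max-player wants to leave. *)
Lemma max_chooser_value B l (mu : policyA R S n) (nu : policyB R S B) k s :
  is_policyA H mu -> is_policyB H nu -> (k <= H)%N ->
  value_to_go H (fun t s a _ => leave_kernel l t s a)
    (fun _ s _ _ => (s == ord0)%:R) mu nu k s =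
  k%:R - (s != ord0)%:R * staying_time H (leave_rate l mu s) k.
Proof.
move=> muP nuP; elim: k s => [|k IH] s kH /=; first by rewrite mulr0 subr0.
have tH : (H - k.+1 < H)%N by lia.
have [_ mu1] := muP _ tH s; have [_ nu1] := nuP _ tH s.
set u := staying_time H (leave_rate l mu s) k.
transitivity (\sum_a (mu (H - k.+1)%N s a * (k.+1%:R - (s != ord0)%:R * (1 + u))
    + mu (H - k.+1)%N s a * l (H - k.+1)%N s a * ((s != ord0)%:R * u))).
  apply: eq_bigr => a _.
  transitivity ((\sum_b nu (H - k.+1)%N s b) *
    (mu (H - k.+1)%N s a * ((s == ord0)%:R +
     (if s == ord0 then k%:R else l (H - k.+1)%N s a * k%:R +
        (1 - l (H - k.+1)%N s a) * (k%:R - u))))).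
    rewrite mulr_suml; apply: eq_bigr => b _.
    rewrite leave_kernelE !IH ?(ltnW kH) //= ?eqxx.
    by case: eqP => [->|_]; rewrite /= /u ?eqxx; ring.
  rewrite nu1 -[k.+1]addn1 natrD.
  by case: eqP => [->|_]; rewrite /= ?eqxx; ring.
rewrite big_split /= -!mulr_suml mu1 -/(leave_rate l mu s _) /=.
by case: eqP => [->|_]; rewrite /= ?eqxx; ring.
Qed.

Let staying_time_leave l pi s : is_policyA H pi ->
  (forall t, (t < H)%N -> forall s a, 0 <= l t s a <= 1) ->
  0 <= staying_time H (leave_rate l pi s) H <= H%:R.
Proof.
move=> piP l01; apply: staying_time_bounds => // t tH.
exact: leave_rate_bounds piP tH (l01 t tH s).
Qed.

Lemma max_chooser_gap B l (mu mu' : policyA R S n) (nu : policyB R S B) s eps :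
  (forall t, (t < H)%N -> forall s a, 0 <= l t s a <= 1) ->
  is_policyA H mu -> is_policyA H mu' -> is_policyB H nu -> s != ord0 ->
  eps < staying_time H (leave_rate l mu s) H -
        staying_time H (leave_rate l mu' s) H ->
  eps < NE_gap H (fun t s a _ => leave_kernel l t s a)
          (fun _ s _ _ => (s == ord0)%:R) mu nu.
Proof.
move=> l01 muP mu'P nuP s0 lt_eps.
rewrite /NE_gap (bigD1 s) //= !lt_max; apply/orP; left; apply/orP; left.
have le_sup : H%:R - staying_time H (leave_rate l mu' s) H <=
    V1_star_nu H (fun t s a _ => leave_kernel l t s a)
          (fun _ s _ _ => (s == ord0)%:R) nu s.
  (* [sup] dominates its set only if the set is bounded, so the values are first bounded by [H]. *)
  apply: ub_le_sup.
    exists H%:R => _ [pi piP <-]; rewrite /V1 max_chooser_value //.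
    have /andP[u0 _] := staying_time_leave s piP l01.
    by rewrite gerBl mulr_ge0.
  exists mu' => //; by rewrite /V1 max_chooser_value // s0 mul1r.
rewrite /V1 max_chooser_value // s0 mul1r; lra.
Qed.

Lemma min_chooser_gap A l (mu : policyA R S A) (nu nu' : policyB R S n) s eps :
  (forall t, (t < H)%N -> forall s a, 0 <= l t s a <= 1) ->
  is_policyA H mu -> is_policyB H nu -> is_policyB H nu' -> s != ord0 ->
  eps < staying_time H (leave_rate l nu s) H -
        staying_time H (leave_rate l nu' s) H ->
  eps < NE_gap H (fun t s _ b => leave_kernel l t s b)
          (fun _ s _ _ => (s != ord0)%:R) mu nu.
Proof.
move=> l01 muP nuP nu'P s0 lt_eps.
rewrite /NE_gap (bigD1 s) //= !lt_max; apply/orP; left; apply/orP; right.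
have inf_le : V1_mu_star H (fun t s _ b => leave_kernel l t s b)
          (fun _ s _ _ => (s != ord0)%:R) mu s <=
      staying_time H (leave_rate l nu' s) H.
  apply: ge_inf.
    exists 0 => _ [pi piP <-]; rewrite /V1 min_chooser_value //.
    have /andP[u0 _] := staying_time_leave s piP l01.
    by rewrite mulr_ge0.
  exists nu' => //; by rewrite /V1 min_chooser_value // s0 mul1r.
rewrite /V1 min_chooser_value // s0 mul1r; lra.
Qed.

End LeaveGame.

(** * The family of games with secret actions *)

Section HardFamily.
Variables (R : realType) (S' H' m : nat) (p d : R).
Notation S := S'.+1.
Notation H := H'.+1.
Notation act := 'I_m.+2.
Notation cell := ('I_H * 'I_S)%type.
Notation secret := {ffun cell -> bool * 'I_m.+1}.
Hypotheses (p_gt0 : 0 < p) (d_gt0 : 0 < d) (pd_le : p + 2 * d <= 2^-1).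
Implicit Types (th : secret) (x : cell) (a : act).

(** A secret stores an index even where its boolean declares it absent: presence can be flipped and
    the index averaged independently. [lift ord0] keeps the secret action apart from action 0. *)
Definition best_action th x : act :=
  if (th x).1 then lift ord0 (th x).2 else ord0.

Definition leave_prob th (t : nat) (s : 'I_S) (a : act) : R :=
  p + d * (a == ord0)%:R +
  2 * d * ((th (inord t, s)).1 && (a == lift ord0 (th (inord t, s)).2))%:R.

Lemma leave_prob_bounds th t s a : 0 <= leave_prob th t s a <= p + 2 * d.
Proof.
rewrite /leave_prob.
have [->|_] := eqVneq a ord0.
  by rewrite (negPf (neq_lift _ _)) andbF /=; have := p_gt0; have := d_gt0; lra.
by case: (_ && (_ == _)) => /=; have := p_gt0; have := d_gt0; lra.
Qed.

Definition best_policy th (t : nat) (s : 'I_S) (a : act) : R :=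
  (a == best_action th (inord t, s))%:R.

Lemma best_policy_valid th : is_policyA H (best_policy th).
Proof.
move=> t _ s; split=> [a|]; first by rewrite /best_policy.
rewrite /best_policy (bigD1 (best_action th (inord t, s))) //= eqxx.
by rewrite big1 ?addr0 // => a /negPf ->.
Qed.

(** The best action beats all others by at least [d]: [p + 2 * d] against [p + d] if the secret is
    present, [p + d] against [p] otherwise. *)
Lemma leave_rate_gap th (pi : policyA R S m.+2) s t :
  is_policyA H pi -> (t < H)%N ->
  d * (1 - pi t s (best_action th (inord t, s))) <=
  leave_rate (leave_prob th) (best_policy th) s t -
  leave_rate (leave_prob th) pi s t.
Proof.
have pg0 := p_gt0; have dg0 := d_gt0.
move=> /(_ t) P tH; have [pi0 pi1] := P tH s.
set x := (inord t, s).
have sumE b : \sum_a pi t s a * (a == b)%:R = pi t s b.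
  rewrite (bigD1 b) //= eqxx mulr1 big1 ?addr0 // => a /negPf ->.
  by rewrite mulr0.
have -> : leave_rate (leave_prob th) (best_policy th) s t =
    leave_prob th t s (best_action th x).
  rewrite /leave_rate (bigD1 (best_action th x)) //= /best_policy eqxx mul1r.
  by rewrite big1 ?addr0 // => a /negPf ->; rewrite mul0r.
have -> : leave_rate (leave_prob th) pi s t = p + d * pi t s ord0 +
    2 * d * ((th x).1%:R * pi t s (lift ord0 (th x).2)).
  rewrite /leave_rate /leave_prob -/x.
  under eq_bigr do rewrite -mulnb natrM !mulrDr [pi t s _ * (d * _)]mulrCA
    [pi t s _ * (2 * d * _)]mulrCA [pi t s _ * (_ * _)%R]mulrCA.
  by rewrite !big_split /= -mulr_suml -!mulr_sumr pi1 !sumE mul1r.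
have := pi0 ord0; have := pi0 (lift ord0 (th x).2).
have le1 : pi t s ord0 + pi t s (lift ord0 (th x).2) <= 1.
  rewrite -pi1 big_ord_recl lerD2l (bigD1 (th x).2) //= lerDl.
  by apply: sumr_ge0.
rewrite /leave_prob /best_action -/x; case: (th x).1 => /= ? ?.
  by rewrite eqxx /=; nra.
by nra.
Qed.

Definition flip x th : secret :=
  [ffun y => if y == x then (~~ (th y).1, (th y).2) else th y].

Definition shift x (j : 'I_m.+1) th : secret :=
  [ffun y => if y == x then ((th y).1, (th y).2 + j) else th y].

Lemma flipK x : involutive (flip x).
Proof.
move=> th; apply/ffunP => y; rewrite !ffunE; case: eqP => //= _.
by rewrite negbK; case: (th y).
Qed.

Lemma shift_inj x j : injective (shift x j).
Proof.
move=> th th' /ffunP E; apply/ffunP => y; have := E y; rewrite !ffunE.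
case: eqP => //= _ E2.
have /addIr := congr1 snd E2; have := congr1 fst E2.
by case: (th y) (th' y) => [? ?] [? ?] /= -> ->.
Qed.

Lemma sum_flip x (f : secret -> R) :
  \sum_th f th = \sum_(th : secret | ~~ (th x).1) (f th + f (flip x th)).
Proof.
rewrite (bigID (fun th => ~~ (th x).1)) /= big_split; congr (_ + _).
rewrite (reindex_inj (inv_inj (flipK x))) /=; apply: eq_bigl => th.
by rewrite ffunE eqxx /= negbK.
Qed.

(* Here [Z th j] depends on the secret of the cell [x] through its boolean
   component only, so the second component can be averaged out. *)
Lemma sum_shift x (Z : secret -> 'I_m.+1 -> R) :
  (forall th j i, ~~ (th x).1 -> Z (shift x j th) i = Z th i) ->
  m.+1%:R * \sum_(th : secret | ~~ (th x).1) Z th (th x).2 =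
  \sum_(th : secret | ~~ (th x).1) \sum_j Z th j.
Proof.
move=> Zs.
transitivity (\sum_(j < m.+1) \sum_(th : secret | ~~ (th x).1)
    Z th ((th x).2 + j)).
  rewrite mulr_natl -[X in _ *+ X]card_ord -sumr_const; apply: eq_bigr => j _.
  rewrite (reindex_inj (@shift_inj x j)) /=.
  apply: eq_big => th; rewrite ffunE eqxx //= => thx.
  by rewrite Zs.
rewrite exchange_big; apply: eq_bigr => th _ /=.
by rewrite [RHS](reindex_inj (addrI (th x).2)).
Qed.

Section Query.
Variables (N : nat) (qry : seq 'I_S -> cell * act).

Definition answer_prob th (h : seq 'I_S) (s' : 'I_S) : R :=
  let: (t, s, a) := qry h in leave_kernel (leave_prob th) t s a s'.

Definition expect th (F : N.-tuple 'I_S -> R) : R :=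
  \sum_o path_prob (answer_prob th) o * F o.

Definition queries x a (o : N.-tuple 'I_S) : R :=
  path_sum (fun h _ => (qry h == (x, a))%:R) o.

Lemma answer_prob_stochastic th h :
  (forall s, 0 <= answer_prob th h s) /\ \sum_s answer_prob th h s = 1.
Proof.
rewrite /answer_prob; case: (qry h) => [[t s] a].
apply: leave_kernel_stochastic.
have /andP[l0 lM] := leave_prob_bounds th t s a.
by have pd := pd_le; rewrite l0 /=; lra.
Qed.

Lemma expect_mono th F G : (forall o, F o <= G o) -> expect th F <= expect th G.
Proof.
move=> FG; apply: ler_sum => o _; rewrite ler_wpM2l //.
by apply: path_prob_ge0 => h s; have [] := answer_prob_stochastic th h.
Qed.

Lemma expect_cst th c : expect th (fun=> c) = c.
Proof.
rewrite /expect -mulr_suml path_prob_sum1 ?mul1r // => h.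
by have [] := answer_prob_stochastic th h.
Qed.

Lemma expectD th F G :
  expect th (fun o => F o + G o) = expect th F + expect th G.
Proof. by rewrite -big_split; apply: eq_bigr => o _; rewrite mulrDr. Qed.

Lemma expect_sum th (I : finType) (P : pred I) (F : I -> N.-tuple 'I_S -> R) :
  expect th (fun o => \sum_(i | P i) F i o) = \sum_(i | P i) expect th (F i).
Proof.
by rewrite exchange_big; apply: eq_bigr => o _; rewrite mulr_sumr.
Qed.

(** The index of an absent secret does not enter the leaving probabilities. *)
Lemma expect_shift x j th F : ~~ (th x).1 ->
  expect (shift x j th) F = expect th F.
Proof.
move=> thx; apply: eq_bigr => o _; congr (_ * _).
apply: eq_bigr => i _; rewrite /answer_prob; case: (qry _) => [[t s] a].
rewrite /leave_kernel.
suff -> : leave_prob (shift x j th) t s a = leave_prob th t s a by [].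
rewrite /leave_prob !inord_val ffunE.
by case: ((t, s) =P x) => [->|//]; rewrite /= (negPf thx).
Qed.

(** The two games differ only in the answers to one query, for which the leaving probability rises
    from [p] to [p + 2 * d]. Its divergence is at most the chi-square divergence, hence at most
    [8 * d ^+ 2 / p]. *)
Lemma expect_flip x th F c :
  x.2 != ord0 -> ~~ (th x).1 -> 0 < c -> (forall o, 0 <= F o <= 1) ->
  expect (flip x th) F <= expect th F + c + (1 + c^-1) * (8 * d ^+ 2 / p) *
    expect th (queries x (lift ord0 (th x).2)).
Proof.
have pg0 := p_gt0; have dg0 := d_gt0; have pd := pd_le.
move=> x0 thx c0 F01; set b := lift ord0 (th x).2.
(* The likelihood ratio of the next answer in the two games. *)
pose rho (h : seq 'I_S) (s' : 'I_S) : R :=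
  if qry h == (x, b) then
    if s' == ord0 then (p + 2 * d) / p else (1 - (p + 2 * d)) / (1 - p)
  else 1.
have p0 : p != 0 by rewrite gt_eqF.
have p1 : 1 - p != 0 by rewrite gt_eqF //; lra.
have thb : leave_prob th x.1 x.2 b = p.
  by rewrite /leave_prob inord_val -surjective_pairing (negPf thx) /=; ring.
have flipE h s' : answer_prob (flip x th) h s' = answer_prob th h s' * rho h s'.
  rewrite /answer_prob /rho /leave_kernel; case E : (qry h) => [[t s] a].
  case: ((t, s, a) =P (x, b)) => [[ex ea]|ne].
    have -> : leave_prob (flip x th) t s a = p + 2 * d.
      rewrite /leave_prob inord_val ex ea ffunE eqxx /= thx eqxx /=; ring.
    have -> : leave_prob th t s a = p by rewrite ea -[RHS]thb -ex.
    have s0 : s != ord0 by move: x0; rewrite -ex.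
    rewrite (negPf s0); have [->|_] := eqVneq s' ord0.
      by rewrite eq_sym (negPf s0) /=; field.
    by case: (s' == s) => /=; field.
  suff -> : leave_prob (flip x th) t s a = leave_prob th t s a.
    by rewrite mulr1.
  rewrite /leave_prob inord_val ffunE.
  case: ((t, s) =P x) => [ex|//] /=; rewrite ex thx (negPf thx) /=.
  by case: (a =P lift _ _) => // ea; case: ne; rewrite ex ea.
have stoch h := answer_prob_stochastic th h.
rewrite /expect.
under eq_bigr => o _.
  have -> : path_prob (answer_prob (flip x th)) o =
      path_prob (fun h s => answer_prob th h s * rho h s) o.
    by apply: eq_bigr => i _; rewrite flipE.
  over.
apply: (@change_of_measure _ _ (answer_prob th) rho
  (fun h => qry h == (x, b))) => //.
- by move=> h s; have [] := stoch h.
- by move=> h; have [] := stoch h.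
- move=> h s; rewrite /rho; case: ifP => // _.
  by case: ifP => _; rewrite divr_gt0 //; lra.
- move=> h; rewrite -[RHS](answer_prob_stochastic (flip x th) h).2.
  by apply: eq_bigr => s _; rewrite flipE.
move=> h; rewrite /rho.
case: (altP (qry h =P (x, b))) => [E|_]; last first.
  by rewrite mulr0 big1 // => s _; rewrite ln1 oppr0 mulr0.
have -> : \sum_s answer_prob th h s *
    - ln (if s == ord0 then (p + 2 * d) / p else (1 - (p + 2 * d)) / (1 - p)) =
    p * - ln ((p + 2 * d) / p) + (1 - p) * - ln ((1 - (p + 2 * d)) / (1 - p)).
  have ansE s : answer_prob th h s = leave_kernel (leave_prob th) x.1 x.2 b s.
    by rewrite /answer_prob E; case: (x).
  under eq_bigr do rewrite ansE.
  rewrite (leave_kernelE _ _ _ _ (fun s => - ln (if s == ord0 then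
    (p + 2 * d) / p else (1 - (p + 2 * d)) / (1 - p)))).
  by rewrite (negPf x0) thb.
(* This passes from the Kullback-Leibler to the chi-square divergence. *)
have inv_ln (y : R) : 0 < y -> - ln y <= y^-1 - 1.
  by move=> y0; rewrite -lnV ?posrE // ln_le_sub1 // invr_gt0.
have q0 : 0 < p + 2 * d by lra.
have q1 : 0 < 1 - (p + 2 * d) by lra.
have := inv_ln ((p + 2 * d) / p) (divr_gt0 q0 pg0).
have := inv_ln ((1 - (p + 2 * d)) / (1 - p)).
rewrite divr_gt0 //; last by lra.
move=> /(_ isT); rewrite !invf_div => ln1 ln0.
apply: (@le_trans _ _ (p * (p / (p + 2 * d) - 1) +
    (1 - p) * ((1 - p) / (1 - (p + 2 * d)) - 1))).
  by rewrite lerD // ler_wpM2l //; lra.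
have -> : p * (p / (p + 2 * d) - 1) +
    (1 - p) * ((1 - p) / (1 - (p + 2 * d)) - 1) =
    4 * d ^+ 2 / ((p + 2 * d) * (1 - (p + 2 * d))).
  by field; rewrite !gt_eqF.
(* The constant doubles because [1 - (p + 2 * d)] is only known to be at least 1/2. *)
rewrite mulr1 (_ : 8 * d ^+ 2 / p = 4 * d ^+ 2 / (p * 2^-1)); last by field.
apply: ler_wpM2l; first by rewrite mulr_ge0 // sqr_ge0.
have le_pq : p * 2^-1 <= (p + 2 * d) * (1 - (p + 2 * d)) by apply: ler_pM; lra.
by rewrite lef_pV2 // posrE mulr_gt0 ?invr_gt0.
Qed.

(** Each of the [N] queries is counted for at most one cell and action. *)
Lemma sum_queries_le (o : N.-tuple 'I_S) (G : pred cell) :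
  \sum_(x | G x) \sum_(j < m.+1) queries x (lift ord0 j) o <= N%:R.
Proof.
apply: (@le_trans _ _ (\sum_x \sum_a queries x a o)).
  rewrite [X in _ <= X](bigID G) /= -[X in X <= _]addr0; apply: lerD.
    apply: ler_sum => x _; rewrite [X in _ <= X]big_ord_recl lerDr.
    by apply: sumr_ge0.
  by apply: sumr_ge0 => x _; apply: sumr_ge0 => a _; apply: sumr_ge0.
rewrite pair_bigA /= exchange_big /=.
rewrite -[N in X in _ <= X]card_ord -sumr_const; apply: ler_sum => i _.
rewrite (bigD1 (qry (take i o))) //= -surjective_pairing eqxx big1 ?addr0 //.
by move=> y ne; rewrite -surjective_pairing eq_sym (negPf ne).
Qed.

(** [F x a o] is the mass that an estimate puts on [a] in the cell [x]. Games are paired by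
    [flip x]: under the law without the secret, the masses of both best actions sum to at most one,
    and the change of law costs [c] plus a multiple of the queries of the secret action. Averaging
    over the index divides these by [m.+1], and over all cells they sum to at most [N]. *)
Lemma expected_success_le (F : cell -> act -> N.-tuple 'I_S -> R)
    (G : pred cell) c :
  (forall x, G x -> x.2 != ord0) -> 0 < c ->
  (forall x a o, 0 <= F x a o) -> (forall x o, \sum_a F x a o = 1) ->
  \sum_th \sum_(x | G x) expect th (F x (best_action th x)) <=
  #|{: secret}|%:R * (#|G|%:R * ((1 + c) / 2) +
    (1 + c^-1) * (8 * d ^+ 2 / p) * (N%:R / m.+1%:R)).
Proof.
move=> G0 c0 F0 F1; set K := (1 + c^-1) * (8 * d ^+ 2 / p).
have pg0 := p_gt0.
have K0 : 0 <= K.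
  by rewrite mulr_ge0 ?addr_ge0 ?invr_ge0 ?divr_ge0 ?mulr_ge0 ?sqr_ge0 // ltW.
have F01 x a o : 0 <= F x a o <= 1.
  rewrite F0 -(F1 x o) (bigD1 a) //= lerDl; exact: sumr_ge0.
pose cost x th j := expect th (queries x (lift ord0 j)).
have cost0 x th j : 0 <= cost x th j.
  rewrite -(expect_cst th 0); apply: expect_mono => o.
  by apply: sumr_ge0.
have cell_le x : G x -> \sum_th expect th (F x (best_action th x)) <=
    #|{: secret}|%:R * ((1 + c) / 2) +
    K * (m.+1%:R^-1 * \sum_(th : secret | ~~ (th x).1) \sum_j cost x th j).
  move=> Gx.
  (* The sum over all [j] is [m.+1] times the term at the stored index. *)
  rewrite -sum_shift; last by move=> th j i; apply: expect_shift.
  rewrite mulKf ?pnatr_eq0 //.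
  rewrite (sum_flip x (fun th => expect th (F x (best_action th x)))).
  have -> : #|{: secret}|%:R * ((1 + c) / 2) =
      \sum_(th : secret | ~~ (th x).1) (1 + c).
    rewrite -sumr_const mulr_suml (eq_bigr (fun=> (1 + c) / 2)); last first.
      by move=> th _; rewrite mul1r.
    by rewrite (sum_flip x); apply: eq_bigr => th _; field.
  rewrite mulr_sumr -big_split /=; apply: ler_sum => th thx.
  have := expect_flip (G0 x Gx) thx c0 (F01 x (lift ord0 (th x).2)).
  have -> : best_action th x = ord0 by rewrite /best_action (negPf thx).
  have -> : best_action (flip x th) x = lift ord0 (th x).2.
    by rewrite /best_action ffunE eqxx /= thx.
  rewrite -/K -/(cost x th (th x).2).
  have : expect th (F x ord0) + expect th (F x (lift ord0 (th x).2)) <= 1.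
    rewrite -expectD -[X in _ <= X](expect_cst th 1); apply: expect_mono => o.
    rewrite -(F1 x o) big_ord_recl lerD2l (bigD1 (th x).2) //= lerDl.
    by apply: sumr_ge0.
  by lra.
rewrite exchange_big /=; apply: (le_trans (ler_sum _ cell_le)).
rewrite big_split /= sumr_const -!mulr_sumr mulrDr.
apply: lerD; first by rewrite -mulrnAr -(mulr_natl ((1 + c) / 2)).
rewrite [X in _ <= X]mulrCA ler_wpM2l // mulrA [X in _ <= X]mulrC.
rewrite ler_wpM2l ?invr_ge0 //.
apply: (@le_trans _ _ (\sum_(x | G x) \sum_th \sum_j cost x th j)).
  apply: ler_sum => x _.
  rewrite [X in _ <= X](bigID (fun th : secret => ~~ (th x).1)) /=.
  by rewrite lerDl; apply: sumr_ge0 => th _; apply: sumr_ge0.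
rewrite exchange_big /= mulr_natl -sumr_const; apply: ler_sum => th _.
rewrite -(expect_cst th N%:R).
under eq_bigr do rewrite -expect_sum.
rewrite -expect_sum; apply: expect_mono => o; exact: sum_queries_le.
Qed.

End Query.
End HardFamily.

(** * Choice of the rates and the averaging argument *)

Section MinimaxBound.
Variables (R : realType) (S' H' m : nat) (eps : R).
Notation S := S'.+1.
Notation H := H'.+1.
Notation T := H./2.
Notation cell := ('I_H * 'I_S)%type.
Notation act := 'I_m.+2.
Notation secret := {ffun cell -> bool * 'I_m.+1}.
Hypotheses (H_ge2 : (2 <= H)%N) (eps_gt0 : 0 < eps)
  (eps_le : eps <= 960^-1 * H%:R).

Definition leave_base : R := (4 * H%:R)^-1.
Definition leave_bonus : R := 120 * eps / H%:R ^+ 2.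
Definition hidden_leave (th : secret) : nat -> 'I_S -> act -> R :=
  leave_prob leave_base leave_bonus th.

Lemma leave_base_gt0 : 0 < leave_base.
Proof. by rewrite invr_gt0 mulr_gt0. Qed.

Lemma leave_bonus_gt0 : 0 < leave_bonus.
Proof. by rewrite /leave_bonus divr_gt0 ?exprn_gt0 ?mulr_gt0 ?eps_gt0. Qed.

(** The constant 960 is chosen for this: [2 * 120 / 960 = 1 / 4] makes twice the bonus at most
    [leave_base]. *)
Lemma leave_total_le : leave_base + 2 * leave_bonus <= (2 * H%:R)^-1.
Proof.
have h0 : 0 < H%:R :> R by rewrite ltr0n.
have -> : (2 * H%:R)^-1 =
    leave_base + 2 * (120 * (960^-1 * H%:R) / H%:R ^+ 2) :> R.
  rewrite /leave_base; move: (H%:R : R) h0 => h h0.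
  by field; rewrite gt_eqF.
rewrite lerD2l ler_pM2l // /leave_bonus.
by rewrite ler_pM2r ?invr_gt0 ?exprn_gt0 // ler_pM2l ?eps_le.
Qed.

Lemma leave_total_le_half : leave_base + 2 * leave_bonus <= 2^-1.
Proof.
apply: le_trans leave_total_le _.
rewrite lef_pV2 ?posrE ?mulr_gt0 // -[X in X <= _]mulr1 ler_pM2l //.
by rewrite ler1n.
Qed.

Lemma hidden_leave_bounds th t s a : 0 <= hidden_leave th t s a <= 1.
Proof.
have b0 := leave_base_gt0; have d0 := leave_bonus_gt0.
have /andP[-> /= le_l] := leave_prob_bounds b0 d0 th t s a.
by apply: le_trans le_l _; have := leave_total_le_half; lra.
Qed.

Lemma card_first_half : #|[pred t : 'I_H | (t < T)%N]| = T.
Proof.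
rewrite -sum1_card -(big_ord_widen H (fun=> 1%N)) ?sum1_card ?card_ord //.
by lia.
Qed.

(** A mass above [T / 5], at least [H / 15], misses the best actions. Each unit of it costs
    [leave_bonus * (H / 4)], and [staying_time_gap] halves the total. *)
Lemma few_hits_large_gap (th : secret) (pi : policyA R S m.+2) s :
  is_policyA H pi ->
  \sum_(t < H | (t < T)%N) pi t s (best_action th (t, s)) < 4 / 5 * T%:R ->
  eps < staying_time H (leave_rate (hidden_leave th) pi s) H -
        staying_time H (leave_rate (hidden_leave th) (best_policy R th) s) H.
Proof.
move=> piP few.
have b0 := leave_base_gt0; have d0 := leave_bonus_gt0.
have gap t := leave_rate_gap b0 d0 th s piP (t := t).
have bound pi' t : is_policyA H pi' -> (t < H)%N ->
    0 <= leave_rate (hidden_leave th) pi' s t <= leave_base + 2 * leave_bonus.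
  move=> pi'P tH; apply: leave_rate_bounds pi'P tH _ => a.
  exact: leave_prob_bounds.
have pi_le1 t a : (t < H)%N -> pi t s a <= 1.
  move=> tH; have [pi0 <-] := piP t tH s.
  by rewrite (bigD1 a) //= lerDl sumr_ge0.
have bestP := best_policy_valid R th.
have := @staying_time_gap R H (leave_rate (hidden_leave th) pi s)
  (leave_rate (hidden_leave th) (best_policy R th) s).
move=> /(_ (ltn0Sn _)) stg; apply: lt_le_trans (stg _ _); last 2 first.
- move=> t tH; have /andP[-> _] := bound _ _ piP tH.
  rewrite -subr_ge0; apply: le_trans (gap _ tH).
  by rewrite mulr_ge0 ?subr_ge0 ?pi_le1 // ltW.
- move=> t tH; have /andP[_ le_q] := bound _ _ bestP tH.
  exact: le_trans le_q leave_total_le.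
have h0 : 0 < H%:R :> R by rewrite ltr0n.
have T_ge : H%:R / 3 <= T%:R :> R.
  rewrite ler_pdivrMr // -natrM ler_nat; lia.
apply: (@lt_le_trans _ _
  (2^-1 * \sum_(t < H | (t < T)%N)
     leave_bonus * (1 - pi t s (best_action th (t, s))) * (H%:R / 4))).
  rewrite -mulr_suml -mulr_sumr sumrB.
  have -> : \sum_(t < H | (t < T)%N) 1 = T%:R :> R.
    by rewrite sumr_const card_first_half.
  (* The 120 in [leave_bonus] is [2 * 15 * 4]. *)
  have -> : eps = 2^-1 * (leave_bonus * (H%:R / 15) * (H%:R / 4)).
    rewrite /leave_bonus; move: (H%:R : R) h0 => h h0.
    by field; rewrite gt_eqF.
  by rewrite ltr_pM2l ?invr_gt0 // ltr_pM2r ?divr_gt0 // ltr_pM2l //; lra.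
rewrite ler_pM2l ?invr_gt0 //.
rewrite [X in _ <= X](bigID (fun t : 'I_H => (t < T)%N)) /=.
have term_ge0 t : (t < H)%N ->
    0 <= leave_rate (hidden_leave th) (best_policy R th) s t -
    leave_rate (hidden_leave th) pi s t.
  move=> tH; apply: le_trans (gap _ tH).
  by rewrite mulr_ge0 ?subr_ge0 ?pi_le1 // ltW.
rewrite -[X in X <= _]addr0; apply: lerD; last first.
  by apply: sumr_ge0 => t _; rewrite mulr_ge0 ?term_ge0 ?divr_ge0.
apply: ler_sum => t tT; apply: ler_pM.
- by rewrite mulr_ge0 ?subr_ge0 ?pi_le1 // ltW.
- by rewrite divr_ge0.
- by have := gap t (ltn_ord t); rewrite inord_val.
rewrite ler_pdivrMr // mulrAC ler_pdivlMr // -!natrM ler_nat; lia.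
Qed.

(** Only the policy [pi] of the choosing player and an abstract event [fail] enter, so that the
    bound serves both players. If it were false, the average mass on the best actions would exceed
    3/5 by [many], while [upper] and the budget leave at most 14/25. *)
Lemma minimax_bound (N : nat) (Omega : finType) (q : Omega -> R)
    (qry : Omega -> seq 'I_S -> cell * act)
    (pi : Omega -> N.-tuple 'I_S -> policyA R S m.+2)
    (fail : secret -> Omega -> N.-tuple 'I_S -> bool) :
  (0 < S')%N ->
  1000 ^+ 3 * (eps ^+ 2 * N%:R) <= S'%:R * T%:R * m.+1%:R * H%:R ^+ 3 ->
  (forall w, 0 <= q w) -> \sum_w q w = 1 ->
  (forall w o, is_policyA H (pi w o)) ->
  (forall th w o s, s != ord0 ->
    eps < staying_time H (leave_rate (hidden_leave th) (pi w o) s) H -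
          staying_time H (leave_rate (hidden_leave th) (best_policy R th) s) H ->
    fail th w o) ->
  exists th, 1 / 4 <= \sum_w q w *
    expect leave_base leave_bonus (qry w) th (fun o => (fail th w o)%:R).
Proof.
move=> S'0 N_le q0 q1 piP failP.
have [/existsP//|/existsPn no] := boolP [exists th, 1 / 4 <= \sum_w q w *
    expect leave_base leave_bonus (qry w) th (fun o => (fail th w o)%:R)].
have b0 := leave_base_gt0; have d0 := leave_bonus_gt0.
have bd := leave_total_le_half.
have T0 : 0 < T%:R :> R by rewrite ltr0n half_gt0.
pose F w (x : cell) a o := pi w o x.1 x.2 a.
pose hits th s w o :=
  \sum_(t < H | (t < T)%N) F w (t, s) (best_action th (t, s)) o.
pose G := [pred x : cell | (x.1 < T)%N && (x.2 != ord0)].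
have F0 w x a o : 0 <= F w x a o.
  by have [+ _] := piP w o x.1 (ltn_ord _) x.2; apply.
have F1 w x o : \sum_a F w x a o = 1 by have [] := piP w o x.1 (ltn_ord _) x.2.
have many th s : s != ord0 -> 3 / 5 * T%:R <
    \sum_w q w * expect leave_base leave_bonus (qry w) th (hits th s w).
  move=> s0.
  have /(_ th) := no; rewrite -ltNge => fail_lt.
  apply: (@lt_le_trans _ _ (\sum_w q w * (4 / 5 * T%:R * (1 -
    expect leave_base leave_bonus (qry w) th (fun o => (fail th w o)%:R))))).
    under eq_bigr do rewrite mulrCA mulrBr mulr1.
    rewrite -mulr_sumr sumrB q1; nra.
  apply: ler_sum => w _; rewrite ler_wpM2l //.
  have -> : 4 / 5 * T%:R * (1 - expect leave_base leave_bonus (qry w) th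
        (fun o => (fail th w o)%:R)) =
      expect leave_base leave_bonus (qry w) th
        (fun o => 4 / 5 * T%:R * (1 - (fail th w o)%:R)).
    rewrite mulrBr mulr1.
    rewrite -[X in X - _](@expect_cst R S' H' m _ _ b0 d0 bd N (qry w) th).
    by rewrite /expect mulr_sumr -sumrB; apply: eq_bigr => o _; ring.
  apply: expect_mono => // o.
  (* Without failure, the contrapositive of [few_hits_large_gap] forces many hits. *)
  case fo: (fail th w o) => /=; first by rewrite subrr mulr0 sumr_ge0.
  rewrite subr0 mulr1 leNgt; apply/negP => few.
  by have := failP th w o s s0 (few_hits_large_gap (piP w o) few); rewrite fo.
have := @expected_success_le R S' H' m leave_base leave_bonus b0 d0 bd N.
have cardG : #|G| = (S' * T)%N.
  rewrite (eq_card (_ : _ =i [predX [pred t : 'I_H | (t < T)%N] &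
    predC1 (ord0 : 'I_S)])) // cardX.
  by rewrite card_first_half cardC1 card_ord mulnC.
move=> success.
(* Taking [c = 10^-1] gives 11/20, which leaves room below 3/5 for the information term. *)
have upper : \sum_th \sum_(s | s != ord0) \sum_w q w *
      expect leave_base leave_bonus (qry w) th (hits th s w) <=
    #|{: secret}|%:R * (#|G|%:R * ((1 + 10^-1) / 2) +
      (1 + 10^-1^-1) * (8 * leave_bonus ^+ 2 / leave_base) * (N%:R / m.+1%:R)).
  set bound := leRHS; rewrite -[bound]mul1r -q1 mulr_suml.
  rewrite (_ : \sum_th _ = \sum_w q w * \sum_th \sum_(x | G x)
      expect leave_base leave_bonus (qry w) th (F w x (best_action th x))).
    apply: ler_sum => w _; rewrite ler_wpM2l //; apply: success => //.
      by move=> x /andP[].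
    by rewrite invr_gt0.
  under eq_bigr do rewrite exchange_big.
  rewrite exchange_big; apply: eq_bigr => w _; rewrite mulr_sumr.
  apply: eq_bigr => th _; rewrite -mulr_sumr; congr (_ * _).
  under eq_bigr do rewrite expect_sum.
  rewrite exchange_big (pair_big (fun t : 'I_H => (t < T)%N)
    (fun s : 'I_S => s != ord0)) /=.
  by apply: eq_bigr => -[t s].
have lower : #|{: secret}|%:R * (S'%:R * (3 / 5 * T%:R)) <=
   \sum_th \sum_(s | s != ord0) \sum_w q w *
      expect leave_base leave_bonus (qry w) th (hits th s w).
  apply: (@le_trans _ _ (\sum_(th : secret) \sum_(s : 'I_S | s != ord0)
      3 / 5 * T%:R)).
    by rewrite !sumr_const cardC1 card_ord /= !mulr_natl.
  apply: ler_sum => th _; apply: ler_sum => s s0; exact/ltW/many.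
have Theta0 : 0 < #|{: secret}|%:R :> R.
  by rewrite ltr0n; apply/card_gt0P; exists [ffun=> (false, ord0)].
have := le_trans lower upper; rewrite ler_pM2l // cardG natrM [leLHS]mulrCA.
have h0 : 0 < H%:R :> R by rewrite ltr0n.
have n0 : 0 < m.+1%:R :> R by rewrite ltr0n.
have S0 : 0 < S'%:R :> R by rewrite ltr0n.
have ST0 := mulr_gt0 S0 T0.
set X := eps ^+ 2 * N%:R / (m.+1%:R * H%:R ^+ 3).
have -> : 8 * leave_bonus ^+ 2 / leave_base =
    32 * (120 * (120 * (eps ^+ 2 / H%:R ^+ 3))).
  rewrite /leave_bonus /leave_base; move: (H%:R : R) (120 : R) h0 => h c h0'.
  by field; rewrite gt_eqF.
have cube (c y : R) : c * (c * (c * y)) = c ^+ 3 * y by ring.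
have X_le : 1000 * (1000 * (1000 * X)) <= S'%:R * T%:R.
  rewrite cube /X [leLHS]mulrA ler_pdivrMr ?mulr_gt0 ?exprn_gt0 //.
  by rewrite [leRHS]mulrA.
(* Here [352 = 11 * 32]. *)
have -> : (1 + 10^-1^-1) * (32 * (120 * (120 * (eps ^+ 2 / H%:R ^+ 3)))) *
    (N%:R / m.+1%:R) = 352 * (120 * (120 * X)).
  rewrite invrK /X.
  move: (H%:R : R) (m.+1%:R : R) (120 : R) h0 n0 => h n c h0' n0'.
  by field; rewrite !gt_eqF.
move: X_le ST0; move: (S'%:R * T%:R) => Y.
set X1 := 1000 * X; set X2 := 1000 * X1 => X_le Y0.
have X0 : 0 <= X.
  apply: divr_ge0; apply: mulr_ge0 => //; first exact: sqr_ge0.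
  exact: exprn_ge0.
(* In two steps with small numerals, the information term is at most [10 * X2], hence at most
   [Y / 100]. *)
have : 120 * (120 * X) <= 15 * X1 by rewrite /X1; lra.
have X1_ge0 : 0 <= X1 by apply: mulr_ge0.
have : 352 * (15 * X1) <= 10 * X2 by rewrite /X2; lra.
by lra.
Qed.

End MinimaxBound.

(** * Sample budget and the two choices of the player *)

(** The 24 is [2 * 3 * 4], from [S'.+1 <= 2 * S'], [H <= 3 * H./2] and [K <= 4 * m.+1]. *)
Lemma sample_budget (R : realType) (S' H m K N : nat) (eps : R) :
  (0 < S')%N -> (2 <= H)%N -> (K <= 4 * m.+1)%N -> 0 < eps ->
  N%:R <= (24 * 1000 ^+ 3)^-1 * H%:R ^+ 4 * S'.+1%:R * K%:R / eps ^+ 2 ->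
  1000 ^+ 3 * (eps ^+ 2 * N%:R) <= S'%:R * H./2%:R * m.+1%:R * H%:R ^+ 3.
Proof.
move=> S0 H2 Km eps0; rewrite ler_pdivlMr ?exprn_gt0 // [eps ^+ 2 * _]mulrC.
have c0 : 0 < 1000 ^+ 3 :> R by rewrite exprn_gt0.
move/(ler_wpM2l (ltW c0))/le_trans; apply.
have splitE (c h s k : R) : 0 < c ->
    c * ((24 * c)^-1 * h ^+ 4 * s * k) = s / 2 * (h / 3) * (k / 4) * h ^+ 3.
  by move=> c_gt0; field; rewrite gt_eqF.
rewrite splitE //.
have S_le : S'.+1%:R / 2 <= S'%:R :> R.
  by rewrite ler_pdivrMr // -natrM ler_nat; lia.
have H_le : H%:R / 3 <= H./2%:R :> R.
  by rewrite ler_pdivrMr // -natrM ler_nat; lia.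
have K_le : K%:R / 4 <= m.+1%:R :> R.
  by rewrite ler_pdivrMr // -natrM ler_nat; lia.
rewrite ler_wpM2r ?exprn_ge0 //.
have ge0 a b : 0 <= a%:R / b%:R :> R by rewrite divr_ge0.
by apply: ler_pM => //; [rewrite mulr_ge0 | apply: ler_pM].
Qed.

(** The reward is common to all games of the family, so with a single state, a single stage or a
    single action on both sides there is nothing to learn; the lower bounds on the sizes exclude
    these cases. *)
Theorem theorem3 (R : realType) :
  exists c1 c2 : R, 0 < c1 /\ 0 < c2 /\
  forall S A B H : nat,
    (2 <= S)%N -> (2 <= H)%N -> (1 <= A)%N -> (1 <= B)%N -> (3 <= A + B)%N ->
  forall eps : R, 0 < eps -> eps <= c1 * H%:R ->
  exists (Theta : finType) (r : reward R S A B) (P : Theta -> kernel R S A B),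
    is_reward H r /\ (forall th, is_kernel H (P th)) /\
    forall N : nat,
      N%:R <= c2 * H%:R ^+ 4 * S%:R * (A + B)%:R / eps ^+ 2 ->
    forall (Omega : finType) (q : Omega -> R)
           (qry : Omega -> seq 'I_S -> 'I_H * 'I_S * 'I_A * 'I_B)
           (out : Omega -> N.-tuple 'I_S -> policyA R S A * policyB R S B),
      (forall w, 0 <= q w) -> \sum_(w : Omega) q w = 1 ->
      (forall w o, is_policyA H (out w o).1 /\ is_policyB H (out w o).2) ->
      exists th : Theta, 1 / 4 <= fail_prob q qry out (P th) r eps.
Proof.
exists 960^-1, (24 * 1000 ^+ 3)^-1; split; first by rewrite invr_gt0.
split; first by rewrite invr_gt0 mulr_gt0 ?exprn_gt0.
case=> [|S'] A B [|H'] // S2 H2 A1 B1 AB eps eps0 eps_le.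
(* The player with more actions chooses. If these are [m.+2] many, then
   [A + B <= 2 * m.+2 <= 4 * m.+1]. *)
have [BA|AB_lt] := leqP B A.
- case: A => [|[|m]] in A1 AB BA *; [lia|lia|].
  exists {ffun 'I_H'.+1 * 'I_S'.+1 -> bool * 'I_m.+1}.
  exists (fun _ s _ _ => (s == ord0)%:R).
  exists (fun th t s a _ => leave_kernel (hidden_leave eps th) t s a).
  split; first by move=> t _ s a b; case: (s == ord0); rewrite ?ler01 ?lexx.
  split=> [th t _ s a b|N N_le Omega q qry out q0 q1 outP].
    exact/leave_kernel_stochastic/hidden_leave_bounds.
  have budget : 1000 ^+ 3 * (eps ^+ 2 * N%:R) <=
      S'%:R * (H'.+1)./2%:R * m.+1%:R * H'.+1%:R ^+ 3.
    by apply: (sample_budget (K := (m.+2 + B)%N)) N_le => //; lia.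
  (* The opponent's action is dropped from the queries, as it does not affect the answers. *)
  have [|th le_th] := @minimax_bound R S' H' m eps H2 eps0 eps_le N Omega q
    (fun w h => (qry w h).1) (fun w o => (out w o).1)
    (fun th w o => eps < NE_gap H'.+1
       (fun t s a _ => leave_kernel (hidden_leave eps th) t s a)
       (fun _ s _ _ => (s == ord0)%:R) (out w o).1 (out w o).2)
    S2 budget q0 q1 (fun w o => (outP w o).1).
  + move=> th w o s s0; apply: max_chooser_gap => //; try exact: (outP w o).1.
    * by move=> t _ *; exact: hidden_leave_bounds.
    * exact: best_policy_valid.
    * exact: (outP w o).2.
  + exists th; congr (_ <= _): le_th.
    apply: eq_bigr => w _; congr (_ * _); apply: eq_bigr => o _.
    congr (_ * _); last by case: ifP.
    by apply: eq_bigr => i _; rewrite /answer_prob; case: (qry _ _) => [[[]]].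
(* The mirrored game: the reward is paid outside [ord0]. *)
- case: B => [|[|m]] in B1 AB AB_lt *; [lia|lia|].
  exists {ffun 'I_H'.+1 * 'I_S'.+1 -> bool * 'I_m.+1}.
  exists (fun _ s _ _ => (s != ord0)%:R).
  exists (fun th t s _ b => leave_kernel (hidden_leave eps th) t s b).
  split; first by move=> t _ s a b; case: (s == ord0); rewrite ?ler01 ?lexx.
  split=> [th t _ s a b|N N_le Omega q qry out q0 q1 outP].
    exact/leave_kernel_stochastic/hidden_leave_bounds.
  have budget : 1000 ^+ 3 * (eps ^+ 2 * N%:R) <=
      S'%:R * (H'.+1)./2%:R * m.+1%:R * H'.+1%:R ^+ 3.
    by apply: (sample_budget (K := (A + m.+2)%N)) N_le => //; lia.
  have [|th le_th] := @minimax_bound R S' H' m eps H2 eps0 eps_le N Omega q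
    (fun w h => ((qry w h).1.1, (qry w h).2)) (fun w o => (out w o).2)
    (fun th w o => eps < NE_gap H'.+1
       (fun t s _ b => leave_kernel (hidden_leave eps th) t s b)
       (fun _ s _ _ => (s != ord0)%:R) (out w o).1 (out w o).2)
    S2 budget q0 q1 (fun w o => (outP w o).2).
  + move=> th w o s s0; apply: min_chooser_gap => //; try exact: (outP w o).2.
    * by move=> t _ *; exact: hidden_leave_bounds.
    * exact: (outP w o).1.
    * exact: best_policy_valid.
  + exists th; congr (_ <= _): le_th.
    apply: eq_bigr => w _; congr (_ * _); apply: eq_bigr => o _.
    congr (_ * _); last by case: ifP.
    by apply: eq_bigr => i _; rewrite /answer_prob; case: (qry _ _) => [[[]]].
Qed.
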